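(* Let $X$ be an independent identically distributed cluster (IIDC) random finite set on $\mathbb{X}$ with cardinality probability mass function $\rho(\cdot)$ on $\{0,1,2,\dots\}$ and single-object state probability density $p(\cdot)$ on $\mathbb{X}$, i.e. with RFS density $f(X)=|X|!\,\rho(|X|)\,[p]^X$. Then the cardinality of objects inside the field-of-view $\mathcal{S}$ is distributed according to $$\rho_{\mathcal{S}}(n)=\sum_{m=n}^{\infty}\rho(m)\binom{m}{n}\langle 1_{\mathcal{S}},p\rangle^{n}\,\langle 1-1_{\mathcal{S}},p\rangle^{m-n},\qquad n=0,1,2,\dots,$$ where $\binom{m}{n}$ is the binomial coefficient.
   Context: $\mathbb{X}$ is the single-object (Euclidean) state space and $\mathbb{X}_{\mathrm p}$ is a subspace of it. The field-of-view (FoV) is a compact subset $\mathcal{S}\subset\mathbb{X}_{\mathrm p}$. For $\boldsymbol{x}\in\mathbb{X}$ write $\boldsymbol{x}_{\mathrm p}=\mathrm{proj}_{\mathbb{X}_{\mathrm p}}\boldsymbol{x}$. The generalized indicator is $1_{\mathcal{S}}(\boldsymbol{x})=1$ if $\boldsymbol{x}_{\mathrm p}\in\mathcal{S}$ and $0$ otherwise. Notation: $h^{A}=[h]^{A}=[h(\cdot)]^{A}=\prod_{a\in A}h(a)$ for a finite set $A$, with $h^{\emptyset}=1$; $\langle f,g\rangle=\int_{\mathbb{X}} f(\boldsymbol{x})g(\boldsymbol{x})\,\mathrm{d}\boldsymbol{x}$. The zeroth power of any number is $1$. FoV cardinality distribution: for a finite set $X\subset\mathbb{X}$, the probability that exactly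 $n$ objects are inside $\mathcal{S}$ conditioned on $X$ is $$\rho_{\mathcal{S}}(n\,|\,X)=\sum_{X^n\subseteq X,\ |X^n|=n}[1_{\mathcal{S}}(\cdot)]^{X^n}[1-1_{\mathcal{S}}(\cdot)]^{X\setminus X^n}.$$ For an RFS with density $f$, the FoV cardinality distribution is the set integral $\rho_{\mathcal{S}}(n)=\int\rho_{\mathcal{S}}(n\,|\,X)f(X)\,\delta X$, that is $$\rho_{\mathcal{S}}(n)=\sum_{m=n}^{\infty}\frac{1}{m!}\int_{\mathbb{X}^m}\rho_{\mathcal{S}}(n\,|\,\{\boldsymbol{x}_1,\dots,\boldsymbol{x}_m\})\,f(\{\boldsymbol{x}_1,\dots,\boldsymbol{x}_m\})\,\mathrm{d}\boldsymbol{x}_1\cdots\mathrm{d}\boldsymbol{x}_m.$$ *)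

(* Defs.v *)
From HB Require Import structures.
From mathcomp Require Import all_boot all_order all_algebra.
From mathcomp Require Import finmap.
From mathcomp Require Import all_classical all_reals all_analysis
  measurable_realfun.

Set Implicit Arguments.
Unset Strict Implicit.
Unset Printing Implicit Defensive.

Import Order.TTheory GRing.Theory Num.Theory.
Import numFieldNormedType.Exports.

Local Open Scope classical_set_scope.
Local Open Scope ring_scope.

(* Borel sigma-algebra of the topology of 'M[R]_(m, n). *)
HB.instance Definition _ (R : realType) (m n : nat) :=
  Measurable.copy 'M[R]_(m, n) (g_sigma_algebraType (@open 'M[R]_(m, n))).

Section sigma_finite_pushforward.
Context d1 d2 (T1 : measurableType d1) (T2 : measurableType d2) (R : realType).
Variable mu : {sigma_finite_measure set T1 -> \bar R}.
Variables (f : T1 -> T2) (g : T2 -> T1).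
Hypotheses (mf : measurable_fun [set: T1] f) (mg : measurable_fun [set: T2] g).
Hypothesis fK : cancel f g.

Let nu : {measure set T2 -> \bar R} :=
  measure_function_pushforward__canonical__measure_function_Measure mu mf.

Let nu_sigma_finite : sigma_finite [set: T2] nu.
Proof.
have [F TF Foo] := sigma_finiteT mu.
exists (fun n => g @^-1` F n).
  by rewrite -preimage_bigcup -TF preimage_setT.
move=> k; have [mFk Fkoo] := Foo k; split.
  by rewrite -[X in measurable X]setTI; exact: mg.
rewrite /nu /= /pushforward -comp_preimage (_ : _ @^-1` _ = F k)//.
by apply/seteqP; split => x /=; rewrite fK.
Qed.

(* [pushforward mu f], packaged as a sigma-finite measure; the measurable left
   inverse [g] of [f] only serves to prove sigma-finiteness. *)
Definition sigma_finite_pushforward : {sigma_finite_measure set T2 -> \bar R} :=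
  HB.pack_for {sigma_finite_measure set T2 -> \bar R} (Measure.sort nu)
    (isSFinite.Build _ _ _ _ (sfinite_measure_sigma_finite nu_sigma_finite))
    (isSigmaFinite.Build _ _ _ _ nu_sigma_finite).

End sigma_finite_pushforward.

Section sigma_finite_product.
Context d1 d2 (T1 : measurableType d1) (T2 : measurableType d2) (R : realType).
Variables (m1 : {sigma_finite_measure set T1 -> \bar R})
  (m2 : {sigma_finite_measure set T2 -> \bar R}).

Let m12 : {measure set (T1 * T2)%type -> \bar R} := (m1 \x m2)%E.

Let m12_sigma_finite : sigma_finite [set: T1 * T2] m12.
Proof.
have /sigma_finiteP[F [TF ndF Foo]] := sigma_finiteT m1.
have /sigma_finiteP[G [TG ndG Goo]] := sigma_finiteT m2.
exists (fun n => F n `*` G n).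
  rewrite -setXTT TF TG predeqE => -[x y]; split.
    move=> [/= [n _ Fnx] [k _ Gky]]; exists (maxn n k) => //; split.
    - by move: x Fnx; exact/subsetPset/ndF/leq_maxl.
    - by move: y Gky; exact/subsetPset/ndG/leq_maxr.
  by move=> [n _ []/= ? ?]; split; exists n.
move=> k; have [? ?] := Foo k; have [? ?] := Goo k.
split; first exact: measurableX.
by rewrite /m12 /= product_measure1E// lte_mul_pinfty// ge0_fin_numE.
Qed.

(* [m1 \x m2], packaged as a sigma-finite measure (the canonical instance of
   the library is shadowed by the one for subprobabilities). *)
Definition sigma_finite_product :
    {sigma_finite_measure set (T1 * T2)%type -> \bar R} :=
  HB.pack_for {sigma_finite_measure set (T1 * T2)%type -> \bar R}
    (Measure.sort m12)
    (isSFinite.Build _ _ _ _ (sfinite_measure_sigma_finite m12_sigma_finite))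
    (isSigmaFinite.Build _ _ _ _ m12_sigma_finite).

End sigma_finite_product.

Section tuple_measure.
Context d (T : measurableType d) (R : realType).
Variable mu : {sigma_finite_measure set T -> \bar R}.

Definition tcons n (x : T * n.-tuple T) : n.+1.-tuple T := [tuple of x.1 :: x.2].
Definition tuncons n (t : n.+1.-tuple T) : T * n.-tuple T :=
  (thead t, [tuple of behead t]).

Lemma tconsK n : cancel (@tcons n) (@tuncons n).
Proof. by move=> [x t]; congr pair; apply/val_inj. Qed.

Lemma measurable_tcons n : measurable_fun setT (@tcons n).
Proof. exact: measurable_cons. Qed.

Lemma measurable_tuncons n : measurable_fun setT (@tuncons n).
Proof.
apply: measurable_fun_pair; [exact: measurable_tnth|exact: measurable_behead].
Qed.

Fixpoint tuple_measure n : {sigma_finite_measure set (n.-tuple T) -> \bar R} :=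
  match n with
  | 0 => [the {sigma_finite_measure set _ -> \bar R} of
           \d_([tuple] : 0.-tuple T)]
  | n'.+1 => sigma_finite_pushforward
      (sigma_finite_product mu (tuple_measure n'))
      (@measurable_tcons n') (@measurable_tuncons n') (@tconsK n')
  end.

End tuple_measure.

Section lebesgue_rV.
Variables (R : realType) (d : nat).

Definition row_of_tuple (t : d.-tuple (measurableTypeR R)) : 'rV[R]_d :=
  \row_i tnth t i.
Definition tuple_of_row (x : 'rV[R]_d) : d.-tuple (measurableTypeR R) :=
  [tuple x ord0 i | i < d].

Lemma row_of_tupleK : cancel row_of_tuple tuple_of_row.
Proof. by move=> t; apply: eq_from_tnth => i; rewrite tnth_mktuple mxE. Qed.

Lemma measurable_row_of_tuple : measurable_fun setT row_of_tuple.
Proof.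
apply: (measurability (@open 'rV[R]_d) erefl).
move=> _ [A oA <-]; rewrite setTI.
pose box (q : 'rV[rat]_d) (k : nat) : set 'rV[R]_d :=
  [set x | forall i, ball (ratr (q ord0 i) : R) (k.+1%:R^-1) (x ord0 i)].
pose D : set ('rV[rat]_d * nat) := [set qk | box qk.1 qk.2 `<=` A].
have -> : row_of_tuple @^-1` A =
    \bigcup_(qk in D) (row_of_tuple @^-1` (box qk.1 qk.2)).
  apply/seteqP; split => [t At|t [qk qkD]]; last exact: qkD.
  have /nbhs_ballP[e /= e0 eA] : nbhs (row_of_tuple t) A by exact: open_nbhs_nbhs.
  have [k ke] : exists k : nat, k.+1%:R^-1 + k.+1%:R^-1 < e.
    have e20 : 0 < e / 2 by rewrite divr_gt0.
    have [k _ ke] := near_infty_natSinv_lt (PosNum e20).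
    exists k; rewrite [ltRHS](splitr e) ltrD//; exact: (ke k (leqnn k)).
  have k0 : 0 < k.+1%:R^-1 :> R by rewrite invr_gt0.
  have /choice[q qb] : forall i, exists q : rat,
      ball (ratr q : R) k.+1%:R^-1 (tnth t i).
    move=> i; have [||x [xb [q _ qx]]] :=
        @dense_rat R (ball (tnth t i : R) k.+1%:R^-1).
    - by exists (tnth t i); exact: ballxx.
    - exact: ball_open.
    - by exists q; rewrite qx; exact: ball_sym.
  exists (\row_i q i, k); last by move=> i; rewrite !mxE; exact: qb.
  move=> x /= xb; apply: eA; split => // a i; rewrite (ord1 a) mxE.
  have := xb i; rewrite !mxE => xbi.
  by apply: le_ball (ltW ke) _ _; apply: ball_triangle xbi; exact: ball_sym.
rewrite bigcup_mkcond; apply: countable_bigcupT_measurable.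
  exact: countableP.
move=> [q k]; case: ifPn => // _.
rewrite (_ : _ @^-1` _ = \bigcap_(i in [set` enum 'I_d])
    ((@tnth d (measurableTypeR R)) ^~ i @^-1`
      ball (ratr (q ord0 i) : R) k.+1%:R^-1)); last first.
  apply/seteqP; split => t /= tb i; first by move=> _; have := tb i; rewrite mxE.
  by rewrite mxE; apply: tb; rewrite /= mem_enum.
rewrite bigcap_seq; apply: bigsetI_measurable => i _.
rewrite -[X in measurable X]setTI; apply: measurable_tnth => //.
exact: measurable_ball.
Qed.

Lemma measurable_tuple_of_row : measurable_fun setT tuple_of_row.
Proof.
apply/measurable_fun_tnthP => i.
rewrite (_ : _ \o _ = fun x : 'rV[R]_d => x ord0 i); last first.
  by apply/funext => x; rewrite /= tnth_mktuple.
apply: (measurability _ (RGenOpens.measurableE R)).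
move=> _ [_ [a [b ->] <-]]; rewrite setTI; apply: sub_sigma_algebra.
have /continuousP := @coord_continuous R 1 d ord0 i.
by apply; exact: interval_open.
Qed.

Definition lebesgue_measure_rV : {sigma_finite_measure set 'rV[R]_d -> \bar R} :=
  sigma_finite_pushforward
    (tuple_measure
      [the {sigma_finite_measure set _ -> \bar R} of @lebesgue_measure R] d)
    measurable_row_of_tuple measurable_tuple_of_row row_of_tupleK.

End lebesgue_rV.

Section orthogonal_projection.
Variables (R : realType) (d : nat).
Implicit Types V : 'M[R]_d.

(* Projection (acting by right multiplication) onto the row space of V along
   kermx V^T, its orthogonal complement for the dot product. *)
Definition orthoproj V : 'M[R]_d := proj_mx <<V>>%MS (kermx V^T).

Lemma dotmx_eq0 (u : 'rV[R]_d) : u *m u^T = 0 -> u = 0.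
Proof.
move=> /matrixP/(_ ord0 ord0); rewrite !mxE => /eqP.
under eq_bigr do rewrite mxE -expr2.
rewrite psumr_eq0 => [/allP u0|i _]; last exact: sqr_ge0.
apply/rowP => i; rewrite mxE; apply/eqP; rewrite -sqrf_eq0.
exact: (implyP (u0 i (mem_index_enum i))).
Qed.

Lemma orthoproj_cap V : (<<V>> :&: kermx V^T = 0)%MS.
Proof.
apply/eqP/rowV0P => u; rewrite sub_capmx genmxE => /andP[/submxP[w uE]].
move=> /sub_kermxP uV; apply: dotmx_eq0.
by rewrite {2}uE trmx_mul mulmxA uV mul0mx.
Qed.

Lemma orthoproj_sum V : (1%:M <= <<V>> + kermx V^T)%MS.
Proof.
rewrite sub1mx /row_full mxrank_disjoint_sum; last exact: orthoproj_cap.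
by rewrite mxrank_gen mxrank_ker mxrank_tr subnKC // rank_leq_col.
Qed.

Lemma orthoproj_sub V (x : 'rV[R]_d) : (x *m orthoproj V <= V)%MS.
Proof. by rewrite (submx_trans (proj_mx_sub _ _ _)) ?genmxE. Qed.

Lemma orthoproj_orth V (x : 'rV[R]_d) : (x - x *m orthoproj V) *m V^T = 0.
Proof.
apply/sub_kermxP/proj_mx_compl_sub.
by rewrite (submx_trans (submx1 x)) ?orthoproj_sum.
Qed.

End orthogonal_projection.

Section fov.
Variables (R : realType) (d : nat).
(* The row space of V is the subspace X_p containing the field of view S. *)
Variables (V : 'M[R]_d) (S : set 'rV[R]_d).
Implicit Types (x : 'rV[R]_d) (X Y : {fset 'rV[R]_d}).

Definition fov_indic x : R := \1_S (x *m orthoproj V).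

Definition mexp (h : 'rV[R]_d -> R) X : R := \prod_(x <- X) h x.

Definition fov_card_cond n X : R :=
  \sum_(Y <- fpowerset X | #|` Y| == n)
    mexp fov_indic Y * mexp (fun x => 1 - fov_indic x) (X `\` Y)%fset.

(* The integrand is evaluated at the finite set of the components of t, which has
   fewer than m elements when two components coincide. *)
Definition fov_card (f : {fset 'rV[R]_d} -> R) n : \bar R :=
  (\sum_(n <= m <oo) (m`!%:R^-1)%:E *
    \int[tuple_measure (lebesgue_measure_rV R d) m]_t
      (fov_card_cond n [fset x in val t]%fset * f [fset x in val t]%fset)%:E)%E.

End fov.

Definition iidc_density (R : realType) (d : nat) (rho : nat -> R)
    (p : 'rV[R]_d -> R) (X : {fset 'rV[R]_d}) : R :=
  (#|` X| `!)%:R * rho #|` X| * mexp p X.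

Definition inner (R : realType) (d : nat) (f g : 'rV[R]_d -> R) : R :=
  \int[lebesgue_measure_rV R d]_x (f x * g x).

(* Main.v *)
(* Two components of a tuple drawn from an atomless measure almost surely
   differ, so up to a null set of m-tuples t the set of components of t has m
   elements and the conditional FoV probability is the sum, over the n-subsets A
   of the index set, of the product of 1_S(t_i) for i in A and 1 - 1_S(t_i) for
   i outside A.  By Tonelli each A contributes <1_S, p>^n <1 - 1_S, p>^(m - n),
   and there are C(m, n) of them. *)

Require Import Defs.
From HB Require Import structures.
From mathcomp Require Import all_boot all_order all_algebra.
From mathcomp Require Import finmap.
From mathcomp Require Import all_classical all_reals all_analysis
  measurable_realfun.

Set Implicit Arguments.
Unset Strict Implicit.
Unset Printing Implicit Defensive.

Import Order.TTheory GRing.Theory Num.Theory.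
Import numFieldNormedType.Exports.

Local Open Scope classical_set_scope.
Local Open Scope ring_scope.

(** * Integrals of nonnegative functions that may fail to be measurable *)

Section integral_eq_off_null.
Local Open Scope ereal_scope.
Context d (T : measurableType d) (R : realType).
Variable mu : {measure set T -> \bar R}.

(** The integral is a supremum over the simple functions below the integrand, and raising the
    integrand only enlarges that family. This applies to integrands on finite sets of components,
    whose measurability is not established. *)
Lemma nonmeasurable_ge0_le_integral (f g : T -> \bar R) :
  (forall x, 0 <= f x) -> (forall x, f x <= g x) ->
  \int[mu]_x f x <= \int[mu]_x g x.
Proof.
move=> f0 fg.
have g0 x : 0 <= g x := le_trans (f0 x) (fg x).
rewrite !ge0_integralTE//; apply: le_ereal_sup => _ [h hf <-].
by exists h => // x; exact: le_trans (hf x) (fg x).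
Qed.

(* As f need not be measurable, its integral is squeezed between those of g
   restricted to the complement of N and of g + oo 1_N. *)
Lemma ge0_integral_eq_off_null (N : set T) (f g : T -> \bar R) :
  measurable N -> mu N = 0 -> measurable_fun [set: T] g ->
  (forall x, 0 <= f x) -> (forall x, 0 <= g x) ->
  (forall x, ~ N x -> f x = g x) ->
  \int[mu]_x f x = \int[mu]_x g x.
Proof.
move=> mN muN0 mg f0 g0 fg; apply/eqP; rewrite eq_le; apply/andP; split.
- have moo : measurable_fun [set: T] (cst +oo \_ N : T -> \bar R).
    by apply/(measurable_restrictT _ mN).1; exact: measurable_cst.
  have oo0 x : 0 <= (cst +oo \_ N : T -> \bar R) x.
    by apply: erestrict_ge0 => ? _; exact: leey.
  have <- : \int[mu]_x (g x + (cst +oo \_ N) x) = \int[mu]_x g x.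
    rewrite ge0_integralD// -integral_mkcond integral_cst// muN0 mule0.
    by rewrite adde0.
  apply: nonmeasurable_ge0_le_integral => // x; rewrite patchE.
  case: ifPn => [_|/negP xN].
    by rewrite addey ?leey// gt_eqF// (lt_le_trans ltNy0).
  by rewrite adde0 fg//; move/mem_set.
- rewrite (ge0_negligible_integral mN)// setTD integral_mkcond.
  apply: nonmeasurable_ge0_le_integral => x.
    by apply: erestrict_ge0 => ? _.
  by rewrite patchE; case: ifPn => // /set_mem/fg ->.
Qed.

End integral_eq_off_null.

(** * Tuple measures: Tonelli for products, negligibility of repeated components *)

Lemma measurable_set1_diag d (T : measurableType d) :
  measurable [set xy : T * T | xy.1 = xy.2] ->
  forall x : T, measurable [set x].
Proof.
move=> mdiag x.
(* A singleton is a section of the diagonal. *)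
rewrite (_ : [set x] = (fun y => (x, y)) @^-1` [set xy | xy.1 = xy.2]).
  by rewrite -[X in measurable X]setTI; exact: measurable_pair1.
by apply/seteqP; split => y.
Qed.

Section tuple_measure_theory.
Context d (T : measurableType d) (R : realType).
Variable mu : {sigma_finite_measure set T -> \bar R}.
Local Open Scope ereal_scope.

Lemma tuple_measureS n (A : set (n.+1.-tuple T)) :
  tuple_measure mu n.+1 A = (mu \x tuple_measure mu n) (@tcons _ T n @^-1` A).
Proof. by []. Qed.

Lemma integral_tuple_measureS n (f : n.+1.-tuple T -> \bar R) :
  measurable_fun [set: n.+1.-tuple T] f -> (forall t, 0 <= f t) ->
  \int[tuple_measure mu n.+1]_t f t =
  \int[mu]_x \int[tuple_measure mu n]_t f [tuple of x :: t].
Proof.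
move=> mf f0.
have := @ge0_integral_pushforward _ _ _ _ R _ (@measurable_tcons _ T n)
  (mu \x tuple_measure mu n) setT f measurableT mf (fun t _ => f0 t).
rewrite preimage_setT /= => ->.
by rewrite fubini_tonelli1//; exact: measurableT_comp (@measurable_tcons _ T n).
Qed.

Lemma measurable_prod_tnth n (h : 'I_n -> T -> R) :
  (forall i, measurable_fun [set: T] (h i)) ->
  measurable_fun [set: n.-tuple T]
    (fun t => (\prod_(i < n) h i (tnth t i))%:E).
Proof.
move=> mh; apply/measurable_EFinP; apply: measurable_prod => i _.
exact: (measurableT_comp (mh i) (measurable_tnth i)).
Qed.

(** Induction on [n], peeling off the first component: the integral over the others is a constant,
    and nonnegativity lets it be pulled out even when infinite. *)
Lemma integral_tuple_prod n (h : 'I_n -> T -> R) :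
  (forall i, measurable_fun [set: T] (h i)) -> (forall i x, 0 <= h i x)%R ->
  \int[tuple_measure mu n]_t (\prod_(i < n) h i (tnth t i))%:E =
  \prod_(i < n) \int[mu]_x (h i x)%:E.
Proof.
elim: n h => [|n IH] h mh h0.
  under eq_integral do rewrite big_ord0.
  by rewrite big_ord0 integral_cst//= diracE in_setT mule1.
rewrite integral_tuple_measureS; first last.
- by move=> t; rewrite lee_fin prodr_ge0.
- exact: measurable_prod_tnth.
rewrite big_ord_recl -IH//; set I := (X in _ = _ * X).
have I0 : 0 <= I by apply: integral_ge0 => t _; rewrite lee_fin prodr_ge0.
rewrite -ge0_integralZr//; last by move=> x _; rewrite lee_fin.
  apply: eq_integral => x _; rewrite -ge0_integralZl//; first last.
  - by rewrite lee_fin.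
  - by move=> t _; rewrite lee_fin prodr_ge0.
  - exact: (measurable_prod_tnth (h := fun i => h (lift ord0 i))).
  apply: eq_integral => t _; rewrite -EFinM big_ord_recl tnth0.
  by under eq_bigr do rewrite tnthS.
exact/measurable_EFinP.
Qed.

(** Splitting off the first component leaves a rectangle with one null side; the convention 0 * oo =
    0 covers a side of infinite mass. *)
Lemma tuple_measure_tnth0 n (i : 'I_n) (A : set T) :
  measurable A -> mu A = 0 ->
  tuple_measure mu n [set t | A (tnth t i)] = 0.
Proof.
move=> mA muA0; elim: n i => [[]//|n IH] i; rewrite tuple_measureS.
have [j ->|->] := unliftP ord0 i.
- rewrite (_ : _ @^-1` _ = setT `*` [set t : n.-tuple T | A (tnth t j)]).
    rewrite product_measure1E// ?IH ?mule0//.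
    by rewrite -[X in measurable X]setTI; exact: measurable_tnth.
  by apply/seteqP; split => -[x t] /=; rewrite tnthS => // -[].
- rewrite (_ : _ @^-1` _ = A `*` setT).
    by rewrite product_measure1E//= muA0 mul0e.
  by apply/seteqP; split => -[x t] /=; rewrite tnth0 => // -[].
Qed.

Hypothesis mdiag : measurable [set xy : T * T | xy.1 = xy.2].
Hypothesis mu0 : forall x, mu [set x] = 0.

Let measurable_tnth_eq n (i j : 'I_n) :
  measurable [set t : n.-tuple T | tnth t i = tnth t j].
Proof.
rewrite (_ : [set t | _] =
  (fun t => (tnth t i, tnth t j)) @^-1` [set xy | xy.1 = xy.2])//.
rewrite -[X in measurable X]setTI.
by apply: measurable_fun_pair => //; exact: measurable_tnth.
Qed.

(** If neither index is 0, the set is [setT] times a diagonal of shorter tuples. Otherwise, once the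
    first component is fixed to [x], another one is confined to the null set of the single point
    [x]. *)
Lemma tuple_measure_tnth_eq n (i j : 'I_n) : i != j ->
  tuple_measure mu n [set t : n.-tuple T | tnth t i = tnth t j] = 0.
Proof.
elim: n i j => [[]//|n IH] i j.
have head k : tuple_measure mu n.+1
    [set t : n.+1.-tuple T | tnth t ord0 = tnth t (lift ord0 k)] = 0.
  rewrite tuple_measureS /product_measure1 integral0_eq// => x _ /=.
  rewrite (_ : xsection _ _ = [set t | [set x] (tnth t k)]).
    by apply: tuple_measure_tnth0 => //; exact: measurable_set1_diag.
  by apply/seteqP; split => t;
    rewrite /xsection /= inE /tcons/= tnth0 tnthS => ->.
have [i' ->|->] := unliftP ord0 i; have [j' ->|->] := unliftP ord0 j => ij.
- rewrite tuple_measureS.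
  rewrite (_ : _ @^-1` _ =
      setT `*` [set t : n.-tuple T | tnth t i' = tnth t j']).
    have ij' : i' != j' by apply: contraNneq ij => ->.
    rewrite product_measure1E//=; last exact: measurable_tnth_eq.
    by rewrite (IH _ _ ij') mule0.
  by apply/seteqP; split => -[x t] /=; rewrite !tnthS => // -[].
- by rewrite -[RHS](head i'); congr (tuple_measure _ _ _); apply/seteqP; split.
- exact: head.
- by rewrite eqxx in ij.
Qed.

(** Finitely many null diagonals cover the tuples with a repetition. Negligibility yields the
    measurable null set that [ge0_integral_eq_off_null] takes. *)
Lemma negligible_nonuniq n :
  (tuple_measure mu n).-negligible [set t | ~~ uniq t].
Proof.
pose F (p : 'I_n * 'I_n) := [set t : n.-tuple T | tnth t p.1 = tnth t p.2].
apply: (@negligibleS _ _ _ _ (\big[setU/set0]_(p | p.1 != p.2) F p)).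
  move=> t /= /tuple_uniqP tinj.
  have [[i j] /= [tij /eqP ij]] :
      exists p : 'I_n * 'I_n, tnth t p.1 = tnth t p.2 /\ p.1 <> p.2.
    apply: contrapT => H; apply: tinj => i j tij.
    by apply: contrapT => ij; apply: H; exists (i, j).
  rewrite -bigcup_seq_cond; exists (i, j) => //=.
  by rewrite mem_index_enum.
apply: big_ind => //; first exact: negligible_set0.
  exact: negligibleU.
move=> p p12; apply/negligibleP; last exact: tuple_measure_tnth_eq.
exact: measurable_tnth_eq.
Qed.

End tuple_measure_theory.

(** * Measurability and null points in the space of row vectors *)

Section rV_measurability.
Context (R : realType) (d : nat).
Local Notation rV := 'rV[R]_d.

Lemma measurable_coord_rV (i : 'I_d) :
  measurable_fun [set: rV] (fun x : rV => x ord0 i).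
Proof.
rewrite (_ : (fun x : rV => _) =
  (@tnth d (measurableTypeR R))^~ i \o @tuple_of_row R d).
  exact: measurableT_comp (measurable_tnth i) (@measurable_tuple_of_row R d).
by apply/funext => x; rewrite /= tnth_mktuple.
Qed.

(** Factoring through [row_of_tuple] reduces Borel measurability to that of each coordinate, a
    finite linear combination. *)
Lemma measurable_mulmx_rV (A : 'M[R]_d) :
  measurable_fun [set: rV] (fun x : rV => x *m A).
Proof.
pose f (x : rV) : d.-tuple (measurableTypeR R) :=
  [tuple (x *m A) ord0 j | j < d].
rewrite (_ : (fun x : rV => _) = @row_of_tuple R d \o f).
  apply: measurableT_comp; first exact: measurable_row_of_tuple.
  apply/measurable_fun_tnthP => j.
  rewrite (_ : _ \o _ = fun x : rV => \sum_i x ord0 i * A i j).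
    apply: measurable_sum => i.
    by apply: measurable_funM => //; exact: measurable_coord_rV.
  by apply/funext => x; rewrite /f /= tnth_mktuple mxE.
by apply/funext => x; apply/rowP => j; rewrite [RHS]mxE tnth_mktuple.
Qed.

(** Pairs carry the product sigma-algebra, so the diagonal is cut out by [d] measurable scalar
    equations rather than treated as a closed set. *)
Lemma measurable_diag_rV : measurable [set xy : rV * rV | xy.1 = xy.2].
Proof.
rewrite (_ : [set _ | _] = \bigcap_(i in [set: 'I_d])
    ((fun xy : rV * rV => xy.1 ord0 i - xy.2 ord0 i) @^-1` [set 0])).
  apply: fin_bigcap_measurable; first exact: finite_finset.
  move=> i _; rewrite -[X in measurable X]setTI.
  have mc := measurable_coord_rV i.
  have mB : measurable_fun [set: rV * rV]
      (fun xy : rV * rV => xy.1 ord0 i - xy.2 ord0 i).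
    apply: measurable_funB; first exact: measurableT_comp mc measurable_fst.
    exact: measurableT_comp mc measurable_snd.
  by apply: mB => //; exact: measurable_set1.
apply/seteqP; split => -[x y] /=; first by move=> -> i _ /=; rewrite subrr.
move=> xy; apply/rowP => i; apply/eqP; rewrite -subr_eq0; apply/eqP.
exact: (xy i).
Qed.

(** A point lies in a null hyperplane fixing one coordinate. For [d = 0] there is no such coordinate
    and the measure is a unit point mass. *)
Lemma lebesgue_measure_rV_set1 (x : rV) : (0 < d)%N ->
  lebesgue_measure_rV R d [set x] = 0%E.
Proof.
move=> d0; pose i := Ordinal d0.
apply: (@subset_measure0 _ _ _
  (tuple_measure (@lebesgue_measure R) d)
  (@row_of_tuple R d @^-1` [set x]) [set t | [set x ord0 i] (tnth t i)]).
- rewrite -[X in measurable X]setTI; apply: measurable_row_of_tuple => //.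
  exact: measurable_set1_diag measurable_diag_rV _.
- by rewrite -[X in measurable X]setTI; exact: measurable_tnth.
- by move=> t /= <-; rewrite mxE.
- apply: tuple_measure_tnth0; first exact: measurable_set1.
  exact: lebesgue_measure_set1.
Qed.

Lemma measurable_fov_indic (V : 'M[R]_d) (S : set rV) :
  compact S -> measurable_fun [set: rV] (fov_indic V S).
Proof.
move=> cS; have mS : measurable S.
  rewrite -[S]setCK; apply: measurableC; apply: sub_sigma_algebra => /=.
  by apply: closed_openC; apply: compact_closed.
have mI : measurable_fun [set: rV] (\1_S : rV -> R) by exact: measurable_indic.
exact: measurableT_comp mI (measurable_mulmx_rV _).
Qed.

End rV_measurability.

(** * The conditional cardinality as a sum over index sets *)

Lemma perm_fset_tuple (K : choiceType) m (t : m.-tuple K) :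
  uniq t -> perm_eq [fset x in val t]%fset t.
Proof. by move=> ut; apply: uniq_perm => // x; rewrite inE. Qed.

(** Used from right to left: it spreads a 0/1 value over a sum with at most one nonzero term, ready
    for termwise comparison. *)
Lemma sum_eq_op_natr (R : nzRingType) (K : eqType) (r : seq K) (P : pred K) k :
  uniq r -> k \in r -> \sum_(i <- r | P i) (i == k)%:R = (P k)%:R :> R.
Proof.
move=> ur kr; rewrite big_mkcond (bigD1_seq k)//= eqxx big1 ?addr0.
  by case: (P k).
by move=> i /negPf ->; case: ifP.
Qed.

Section fov_card_cond_theory.
Context (R : realType) (d : nat) (V : 'M[R]_d) (S : set 'rV[R]_d).
Local Notation a := (fov_indic V S).
Let in_fov (x : 'rV[R]_d) := x *m orthoproj V \in S.

Let fov_indicE x : a x = (in_fov x)%:R.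
Proof. by rewrite /fov_indic indicE. Qed.

Lemma fov_indic_ge0 x : 0 <= a x.
Proof. by rewrite fov_indicE ler0n. Qed.

Lemma fov_indicC_ge0 x : 0 <= 1 - a x.
Proof. by rewrite fov_indicE subr_ge0 lern1 leq_b1. Qed.

Lemma fov_card_cond_ge0 n X : 0 <= fov_card_cond V S n X.
Proof.
apply: sumr_ge0 => Y _; apply: mulr_ge0; apply: prodr_ge0 => x _.
  exact: fov_indic_ge0.
exact: fov_indicC_ge0.
Qed.

(* The indicator being 0 or 1, only the subset of the elements of X that lie
   in the field of view contributes. *)
Lemma fov_card_condE n X :
  fov_card_cond V S n X =
  (count (fun x => x *m orthoproj V \in S) X == n)%:R.
Proof.
pose X1 := [fset x in X | in_fov x]%fset.
have X1X : X1 \in fpowerset X.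
  by rewrite fpowersetE; apply/fsubsetP => x; rewrite !inE => /andP[].
have <- : #|` X1| = count in_fov X.
  rewrite -size_filter; apply/perm_size/uniq_perm => //.
    exact/filter_uniq/fset_uniq.
  by move=> x; rewrite mem_filter !inE andbC.
rewrite -(sum_eq_op_natr R (fun Y : {fset 'rV[R]_d} => #|` Y| == n)
  (fset_uniq _) X1X) /fov_card_cond big_seq_cond [RHS]big_seq_cond.
apply: eq_bigr => Y /andP[]; rewrite fpowersetE => /fsubsetP YX _.
have [->|/eqP YX1] := eqVneq Y X1.
  rewrite /mexp !big_seq !big1 ?mulr1// => x; rewrite fov_indicE !inE.
    by case: (in_fov x); rewrite ?andbF ?subr0//= andbT => /andP[/negP].
  by move=> /andP[_ ->].
have [/allP Yfov|/allPn[x xY xfov]] := boolP (all in_fov Y); last first.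
  by rewrite /mexp (big_fsetD1 x)//= fov_indicE (negPf xfov) !mul0r.
have [/allP X1Y|/allPn[x]] := boolP (all (mem Y) X1).
  case: YX1; apply/fsetP => x; apply/idP/idP => [xY|/X1Y//].
  by rewrite !inE YX// Yfov.
rewrite !inE => /andP[xX xfov] xY.
rewrite /mexp [X in _ * X](big_fsetD1 x) ?inE ?xX ?xY//= fov_indicE xfov.
by rewrite subrr mul0r mulr0.
Qed.

(** Only the index set [B] of the components in the field of view gives a nonzero product. Indexing
    by subsets of ['I_m] makes each summand a product over coordinates, as [integral_tuple_prod]
    requires. *)
Lemma fov_card_cond_tuple n m (t : m.-tuple 'rV[R]_d) : uniq t ->
  fov_card_cond V S n [fset x in val t]%fset =
  \sum_(A : {set 'I_m} | #|A| == n)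
     \prod_(i < m) (if i \in A then a (tnth t i) else 1 - a (tnth t i)).
Proof.
move=> ut; rewrite fov_card_condE (permP (perm_fset_tuple ut)).
pose B : {set 'I_m} := [set i | in_fov (tnth t i)]%SET.
have -> : count (fun x => x *m orthoproj V \in S) t = #|B|.
  rewrite -sum1_count big_tuple -sum1_card; apply: eq_bigl => i.
  by rewrite inE.
rewrite -(sum_eq_op_natr R (fun A : {set 'I_m} => #|A| == n)
  (index_enum_uniq _) (mem_index_enum B)).
apply: eq_bigr => A _.
have [->|] := eqVneq A B.
  rewrite big1// => i _; rewrite fov_indicE inE.
  by case: (in_fov _); rewrite ?subr0.
move=> AB; have [i iAB] : exists i, (i \in A) != (i \in B).
  apply/existsP; apply: contraNT AB; rewrite negb_exists => /forallP AB.
  by apply/eqP/setP => i; have /negPn/eqP := AB i.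
(* An index on which [A] and [B] disagree contributes a factor 0. *)
rewrite (bigD1 i)//= fov_indicE; move: iAB; rewrite inE.
by case: (i \in A); case: (in_fov _); rewrite //= ?subrr mul0r.
Qed.

End fov_card_cond_theory.

(** * Integration of the term of index [m], and the final series *)

Lemma EFin_inner (R : realType) (d : nat) (p g : 'rV[R]_d -> R) :
  (forall x, 0 <= p x) -> (\int[lebesgue_measure_rV R d]_x (p x)%:E = 1)%E ->
  (forall x, 0 <= g x <= 1) ->
  (\int[lebesgue_measure_rV R d]_x (g x * p x)%:E = (inner g p)%:E)%E.
Proof.
(* [fine] sends infinity to 0, so finiteness must be checked: [g * p] lies between 0 and [p], which
   has mass 1. *)
move=> p0 p1 g01; rewrite /inner /Rintegral fineK// ge0_fin_numE; last first.
  apply: integral_ge0 => x _; have /andP[g0 _] := g01 x.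
  by rewrite lee_fin mulr_ge0.
apply: le_lt_trans (ltry 1); rewrite -p1.
apply: nonmeasurable_ge0_le_integral => x; have /andP[g0 g1] := g01 x.
  by rewrite lee_fin mulr_ge0.
by rewrite lee_fin ler_piMl.
Qed.

Lemma prodr_if_in (R : comPzRingType) (I : finType) (A : {set I}) (x y : R) :
  \prod_i (if i \in A then x else y) = x ^+ #|A| * y ^+ (#|I| - #|A|).
Proof.
rewrite (bigID (mem A))/=; congr (_ * _).
  by rewrite -prodr_const; apply: eq_bigr => i ->.
rewrite -(cardC (mem A)) addKn -prodr_const; apply: eq_big => // i.
by move=> /negPf ->.
Qed.

(** For [m < n] both sides vanish, since ['C(m, n) = 0], so the truncated [m - n] is harmless. *)
Lemma integral_fov_card_cond (R : realType) (d : nat) (V : 'M[R]_d)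
    (S : set 'rV[R]_d) (rho : nat -> R) (p : 'rV[R]_d -> R) (n m : nat) :
  (0 < d)%N -> compact S -> (forall m, 0 <= rho m) -> (forall x, 0 <= p x) ->
  measurable_fun [set: 'rV[R]_d] p ->
  (\int[lebesgue_measure_rV R d]_x (p x)%:E = 1)%E ->
  (\int[tuple_measure (lebesgue_measure_rV R d) m]_t
     (fov_card_cond V S n [fset x in val t]%fset *
      iidc_density rho p [fset x in val t]%fset)%:E =
   (m`!%:R * rho m * ('C(m, n)%:R * (inner (fov_indic V S) p ^+ n *
     inner (fun x => 1 - fov_indic V S x)%R p ^+ (m - n))))%:E)%E.
Proof.
move=> d0 cS rho0 p0 mp p1.
set a := fov_indic V S; set mu := lebesgue_measure_rV R d.
have ma : measurable_fun setT a by exact: measurable_fov_indic.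
have a0 x : 0 <= a x by exact: fov_indic_ge0.
have b0 x : 0 <= 1 - a x by exact: fov_indicC_ge0.
pose w (A : {set 'I_m}) i x := if i \in A then a x else 1 - a x.
have w0 A i x : 0 <= w A i x * p x by rewrite /w mulr_ge0//; case: ifP.
have mw A i : measurable_fun setT (fun x => w A i x * p x).
  apply: measurable_funM => //; rewrite /w; case: (i \in A) => //.
  exact: measurable_funB.
(* The cardinality condition goes into the list, so that the sums exchanged with the integral carry
   no predicate. *)
pose s := [seq A : {set 'I_m} <- index_enum _ | #|A| == n].
pose P A (t : m.-tuple 'rV[R]_d) :=
  \prod_(i < m) (w A i (tnth t i) * p (tnth t i)).
(* A measurable function equal to the integrand at every tuple without repetition. *)
pose G t := ((m`!%:R * rho m)%:E * \sum_(A <- s) (P A t)%:E)%E.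
have [N [mN N0 nuN]] := negligible_nonuniq (@measurable_diag_rV R d)
  (fun x => @lebesgue_measure_rV_set1 R d x d0) m.
have P0 A t : (0 <= (P A t)%:E)%E by rewrite lee_fin prodr_ge0.
have sP0 t : (0 <= \sum_(A <- s) (P A t)%:E)%E by exact: sume_ge0.
have mP A : measurable_fun [set: m.-tuple 'rV[R]_d] (fun t => (P A t)%:E).
  exact: (measurable_prod_tnth (h := fun i x => w A i x * p x)).
rewrite (ge0_integral_eq_off_null (g := G) mN N0); first last.
- move=> t Nt; have ut : uniq t.
    by apply: contrapT => /negP ut; apply: Nt; exact: nuN.
  rewrite /G sumEFin -EFinM; congr EFin.
  rewrite fov_card_cond_tuple// /iidc_density /mexp.
  rewrite (perm_size (perm_fset_tuple ut)) size_tuple.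
  rewrite (perm_big _ (perm_fset_tuple ut)) big_tuple/= mulrCA; congr (_ * _).
  rewrite mulr_suml big_filter; apply: eq_bigr => A _.
  by rewrite -big_split.
- by move=> t; rewrite /G mule_ge0// lee_fin mulr_ge0.
- move=> t; rewrite lee_fin mulr_ge0 ?fov_card_cond_ge0// /iidc_density.
  by rewrite !mulr_ge0// prodr_ge0.
- by apply: emeasurable_funM => //; exact: emeasurable_sum.
rewrite ge0_integralZl//; first last.
- by rewrite lee_fin mulr_ge0.
- exact: emeasurable_sum.
rewrite ge0_integral_sum//.
rewrite [RHS]EFinM; congr (_ * _)%E.
set al := inner a p; set be := inner _ p.
(* Membership in [s] is not at hand here, so the exponents involve [#|A|]; they become [n] once
   [big_filter] restores the condition. *)
rewrite (eq_bigr (fun A : {set 'I_m} =>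
    (al ^+ #|A| * be ^+ (m - #|A|))%:E)); last first.
  move=> A _; rewrite (integral_tuple_prod mu (h := fun i x => w A i x * p x))//.
  rewrite -[m in (m - _)%N]card_ord -prodr_if_in -prodEFin.
  apply: eq_bigr => i _.
  rewrite /w; case: ifP => _; apply: EFin_inner => // x.
    by rewrite a0/= -subr_ge0.
  by rewrite b0/= gerBl.
rewrite sumEFin big_filter (eq_bigr (fun=> al ^+ n * be ^+ (m - n))); last first.
  by move=> A /eqP ->.
rewrite sumr_const mulr_natl; congr EFin; congr (_ *+ _).
(* The binomial coefficient counts the [n]-subsets of ['I_m]. *)
rewrite -[in RHS](card_ord m) -card_draws.
by apply: eq_card => A; rewrite inE.
Qed.

Theorem proposition2 (R : realType) (d : nat) (d_gt0 : (0 < d)%N)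
    (V : 'M[R]_d) (S : set 'rV[R]_d)
    (S_sub : S `<=` [set x | (x <= V)%MS]) (S_compact : compact S)
    (rho : nat -> R) (rho_ge0 : forall m, 0 <= rho m)
    (rho_sum1 : (\sum_(0 <= m <oo) (rho m)%:E = 1)%E)
    (p : 'rV[R]_d -> R) (p_ge0 : forall x, 0 <= p x)
    (p_meas : measurable_fun [set: 'rV[R]_d] p)
    (p_int1 : (\int[lebesgue_measure_rV R d]_x (p x)%:E = 1)%E)
    (n : nat) :
  fov_card V S (iidc_density rho p) n =
  (\sum_(n <= m <oo)
     (rho m * 'C(m, n)%:R * inner (fov_indic V S) p ^+ n *
      inner (fun x => 1 - fov_indic V S x)%R p ^+ (m - n))%:E)%E.
Proof.
apply: eq_eseriesr => m _; rewrite integral_fov_card_cond// -EFinM.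
(* The 1/m! of the set integral cancels the m! of the cluster density. *)
by rewrite !mulrA mulVf ?mul1r// pnatr_eq0 -lt0n fact_gt0.
Qed.
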